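(* Let $n\ge 1$, $z=(z_1,\dots,z_n)$, and let $t$ be a formal parameter commuting with the $z_i$. Let $H(z)\in\mathbb{C}[[z]]^{n}$ with $o(H(z))\ge 1$ and $N_t(z)\in\mathbb{C}[t][[z]]^{n}$ with $o(N_t(z))\ge 1$. Then the following statements are equivalent. (1) The formal map $G_t(z)=z+tN_t(z)$ is the formal inverse of $F_t(z)=z-tH(z)$. (2) $N_t(z)$ is the unique power series solution (in $z$ and $t$) of the Cauchy problem $$\frac{\partial N_t}{\partial t}=JN_t\cdot N_t,\qquad N_{t=0}(z)=H(z),$$ where $JN_t$ is the Jacobian matrix of $N_t(z)$ with respect to $z$.
   Context: A formal map is an $n$-tuple (column vector) of formal power series in $z$ with coefficients in $\mathbb{C}$, $\mathbb{C}[t]$ or $\mathbb{C}[[t]]$. For a vector $U=(U_1,\dots,U_k)$ of power series, $o(U)=\min_i o(U_i)$, where $o(U_i)$ is the order in $z$, i.e. the lowest total degree in $z$ of a monomial occurring in $U_i$ (with $o(0)=\infty$); $t$ does not count towards the order. Composition of formal maps is in the variables $z$, with $t$ treated as a constant; $G_t$ is the formal inverse of $F_t$ if $F_t(G_t(z))=z=G_t(F_t(z))$. ''Power series solution'' means a solution in $\mathbb{C}[[z,t]]^{n}$. $JN_t\cdot N_t$ is the product of a matrix with a column vector. *)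

(* Defs.v *)
From HB Require Import structures.
From mathcomp Require Import all_boot all_order all_algebra.
From mathcomp Require Import mpoly.
From mathcomp Require Import boolp constructive_ereal reals complex.

Set Implicit Arguments.
Unset Strict Implicit.
Unset Printing Implicit Defensive.

Import Order.TTheory GRing.Theory Num.Theory.
Local Open Scope ring_scope.

Record fps (R : Type) (n : nat) : Type := FPS { fcoef :> 'X_{1..n} -> R }.

Notation "{ 'fps' R [ n ] }" := (fps R n)
  (at level 0, R at level 2, n at level 2, format "{ 'fps'  R [ n ] }")
  : type_scope.

HB.instance Definition _ (R : Type) (n : nat) := gen_eqMixin {fps R[n]}.
HB.instance Definition _ (R : Type) (n : nat) := gen_choiceMixin {fps R[n]}.

Lemma fpsP (R : Type) (n : nat) (f g : {fps R[n]}) : f =1 g -> f = g.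
Proof. by case: f => f; case: g => g /= /funext ->. Qed.

Section Ring.
Variables (R : comNzRingType) (n : nat).
Implicit Types (f g h : {fps R[n]}) (m : 'X_{1..n}).

Definition fps0 : {fps R[n]} := FPS (fun=> 0).
Definition fps1 : {fps R[n]} := FPS (fun m => (m == 0%MM)%:R).
Definition fps_opp f : {fps R[n]} := FPS (fun m => - f m).
Definition fps_add f g : {fps R[n]} := FPS (fun m => f m + g m).
Definition fps_mul f g : {fps R[n]} :=
  FPS (fun m => \sum_(k : 'X_{1..n < (mdeg m).+1, (mdeg m).+1}
                      | m == (k.1 + k.2)%MM) f k.1 * g k.2).

Fact fps_addA : associative fps_add.
Proof. by move=> f g h; apply: fpsP => m /=; rewrite addrA. Qed.
Fact fps_addC : commutative fps_add.
Proof. by move=> f g; apply: fpsP => m /=; rewrite addrC. Qed.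
Fact fps_add0 : left_id fps0 fps_add.
Proof. by move=> f; apply: fpsP => m /=; rewrite add0r. Qed.
Fact fps_addN : left_inverse fps0 fps_opp fps_add.
Proof. by move=> f; apply: fpsP => m /=; rewrite addNr. Qed.

HB.instance Definition _ := GRing.isZmodule.Build {fps R[n]}
  fps_addA fps_addC fps_add0 fps_addN.

(* The ring axioms are transferred from {mpoly R[n]} by truncation. *)
Definition fps_trunc (d : nat) f : {mpoly R[n]} :=
  \sum_(k : 'X_{1..n < d}) f k *: 'X_[k].

Lemma mcoeff_fps_trunc d f m : (mdeg m < d)%N -> (fps_trunc d f)@_m = f m.
Proof.
move=> lt_md; rewrite /fps_trunc raddf_sum /= (bigD1 (BMultinom lt_md)) //=.
rewrite mcoeffZ mcoeffX eqxx mulr1 big1 ?addr0 // => k nk.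
rewrite mcoeffZ mcoeffX; case: eqP => [e|_]; last by rewrite mulr0.
by case/eqP: nk; apply/val_inj.
Qed.

Lemma mcoeffM_eq (p p' q q' : {mpoly R[n]}) m :
  (forall k, (mdeg k <= mdeg m)%N -> p@_k = p'@_k) ->
  (forall k, (mdeg k <= mdeg m)%N -> q@_k = q'@_k) ->
  (p * q)@_m = (p' * q')@_m.
Proof.
move=> ep eq; rewrite !mcoeffM; apply: eq_bigr => -[[k1 h1] [k2 h2]] /= _.
by rewrite ep // eq.
Qed.

Lemma fps_mulE d f g m :
  (mdeg m < d)%N -> fps_mul f g m = (fps_trunc d f * fps_trunc d g)@_m.
Proof.
move=> md; rewrite mcoeffM /=; apply: eq_bigr => -[[k1 h1] [k2 h2]] /= _.
by rewrite !mcoeff_fps_trunc ?(leq_trans _ md).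
Qed.

Lemma fps_truncM d f g m : (mdeg m < d)%N ->
  (fps_trunc d (fps_mul f g))@_m = (fps_trunc d f * fps_trunc d g)@_m.
Proof. by move=> md; rewrite mcoeff_fps_trunc // (fps_mulE _ _ md). Qed.

Fact fps_mulA : associative fps_mul.
Proof.
move=> f g h; apply: fpsP => m; rewrite !(fps_mulE (d := (mdeg m).+1)) //.
rewrite (mcoeffM_eq (p' := fps_trunc (mdeg m).+1 f)
  (q' := fps_trunc (mdeg m).+1 g * fps_trunc (mdeg m).+1 h)) //; last first.
  by move=> k km; rewrite fps_truncM.
rewrite mulrA; apply: mcoeffM_eq => // k km.
by rewrite fps_truncM.
Qed.

Fact fps_mulC : commutative fps_mul.
Proof.
by move=> f g; apply: fpsP => m; rewrite !(fps_mulE (d := (mdeg m).+1)) // mulrC.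
Qed.

Fact fps_mul1 : left_id fps1 fps_mul.
Proof.
move=> f; apply: fpsP => m; rewrite (fps_mulE (d := (mdeg m).+1)) //.
rewrite (mcoeffM_eq (p' := 1) (q' := fps_trunc (mdeg m).+1 f)) //.
  by rewrite mul1r mcoeff_fps_trunc.
by move=> k km; rewrite mcoeff_fps_trunc //= mcoeff1.
Qed.

Fact fps_mulD : left_distributive fps_mul fps_add.
Proof.
move=> f g h; apply: fpsP => m /=; rewrite -big_split /=.
by apply: eq_bigr => k _; rewrite mulrDl.
Qed.

Fact fps_1neq0 : fps1 != fps0.
Proof.
apply/eqP => /(congr1 (fun f => fcoef f 0%MM)) /= /eqP.
by rewrite eqxx oner_eq0.
Qed.

HB.instance Definition _ := GRing.Zmodule_isComNzRing.Build {fps R[n]}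
  fps_mulA fps_mulC fps_mul1 fps_mulD fps_1neq0.

Definition fpsC (a : R) : {fps R[n]} := FPS (fun m => a *+ (m == 0%MM)).

Definition fpsX (i : 'I_n) : {fps R[n]} := FPS (fun m => (m == U_(i)%MM)%:R).

Definition fps_deriv (i : 'I_n) f : {fps R[n]} :=
  FPS (fun m => f (m + U_(i))%MM *+ (m i).+1).

(* Order of a series in its variables; +oo for the zero series. *)
Definition fps_order f : \bar int :=
  match pselect (exists d, `[< exists m, mdeg m = d /\ f m != 0 >]) with
  | left exd => ((ex_minn exd)%:Z%:E)%E
  | right _ => +oo%E
  end.

End Ring.

Definition fps_map (R S : Type) (n : nat) (phi : R -> S) (f : {fps R[n]}) :
  {fps S[n]} := FPS (fun m => phi (f m)).

Section FormalMaps.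
Variable R : comNzRingType.

Definition fmap_order (n k : nat) (U : 'cV[{fps R[n]}]_k) : \bar int :=
  \big[Order.min/+oo%E]_(i < k) fps_order (U i 0).

Definition fmap_id (n : nat) : 'cV[{fps R[n]}]_n := \col_i fpsX R i.

(* f(G), meaningful when G has order at least 1: then G ^ k has order at least
   mdeg k, so only the monomials k of f with mdeg k <= mdeg m contribute to the
   coefficient at m. *)
Definition fps_comp (k n : nat) (f : {fps R[k]}) (G : 'cV[{fps R[n]}]_k) :
    {fps R[n]} :=
  FPS (fun m => \sum_(a : 'X_{1..k < (mdeg m).+1})
                   f a * (\prod_(i < k) G i 0 ^+ a i : {fps R[n]}) m).

Definition fmap_comp (l k n : nat) (F : 'cV[{fps R[k]}]_l)
    (G : 'cV[{fps R[n]}]_k) : 'cV[{fps R[n]}]_l :=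
  \col_i fps_comp (F i 0) G.

Definition is_formal_inverse (n : nat) (F G : 'cV[{fps R[n]}]_n) : Prop :=
  fmap_comp F G = fmap_id n /\ fmap_comp G F = fmap_id n.

Definition jacobian (n k : nat) (U : 'cV[{fps R[n]}]_k) :
  'M[{fps R[n]}]_(k, n) := \matrix_(i, j) fps_deriv j (U i 0).

End FormalMaps.

Section Deformation.
Variables (K : comNzRingType) (n : nat).

(* K[[z, t]] is represented as {fps {fps K[1]}[n]}, that is K[[t]][[z]], and
   K[t][[z]] as {fps {poly K}[n]}. *)

Definition poly_fps (p : {poly K}) : {fps K[1]} := FPS (fun m => p`_(m ord0)).

Definition fmap_poly_fps (N : 'cV[{fps {poly K}[n]}]_n) :
  'cV[{fps {fps K[1]}[n]}]_n := map_mx (fps_map poly_fps) N.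

Definition fmap_polyC (H : 'cV[{fps K[n]}]_n) : 'cV[{fps {poly K}[n]}]_n :=
  map_mx (fps_map polyC) H.

Definition fmap_dt (M : 'cV[{fps {fps K[1]}[n]}]_n) :
  'cV[{fps {fps K[1]}[n]}]_n := map_mx (fps_map (fps_deriv ord0)) M.

Definition fmap_t0 (M : 'cV[{fps {fps K[1]}[n]}]_n) : 'cV[{fps K[n]}]_n :=
  map_mx (fps_map (fun a : {fps K[1]} => a 0%MM)) M.

Definition cauchy_solution (H : 'cV[{fps K[n]}]_n)
    (M : 'cV[{fps {fps K[1]}[n]}]_n) : Prop :=
  fmap_dt M = jacobian M *m M /\ fmap_t0 M = H.

Definition fmap_t : {fps {poly K}[n]} := fpsC n 'X.

End Deformation.

Lemma fmap_order_geP (R : comNzRingType) (n k : nat) (U : 'cV[{fps R[n]}]_k)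
    (d : nat) :
  (d%:Z%:E <= fmap_order U)%E <-> forall i m, (mdeg m < d)%N -> U i 0 m = 0.
Proof.
have ordP (f : {fps R[n]}) :
    (d%:Z%:E <= fps_order f)%E <-> forall m, (mdeg m < d)%N -> f m = 0.
  rewrite /fps_order; case: pselect => [e|ne].
    case: ex_minnP => e0 /asboolP[m [<- fm]] min; rewrite lee_fin lez_nat.
    split=> [le m' lt|f0]; last first.
      by rewrite leqNgt; apply: contra_neqN fm => /f0.
    apply/eqP/negP => /negP fm'.
    have := min (mdeg m') (asboolT (ex_intro _ m' (conj erefl fm'))).
    by rewrite leqNgt (leq_trans lt le).
  split=> [_ m _|]; last by rewrite leey.
  apply/eqP/negP => /negP fm; apply: ne; exists (mdeg m).
  by apply/asboolP; exists m.
rewrite /fmap_order; split=> [le i|f0].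
  apply/ordP; apply: (le_trans le).
  by rewrite (bigD1 i) //= ge_min lexx.
elim/big_ind: _ => [|x y dx dy|i _]; first by rewrite leey.
  by rewrite le_min dx.
by apply/ordP; exact: f0.
Qed.

(* Main.v *)
(** Write z for the identity map and t for the parameter. Cancelling t, the
    inverse relations for F = z - tH and G = z + tN say N = H(G) and N(F) = H.

    If N = H(G) and A = (JH)(G), the chain rule gives dN/dt = A (N + t dN/dt) and
    JN = A (1 + t JN), so Z = dN/dt - JN N satisfies Z = tAZ and is 0 by t-adic
    separation. Conversely, if N solves the Cauchy problem, W = N - H(G) satisfies
    dW/dt = JW N and Q = N(F) - H satisfies dQ/dt = (JN)(F) Q; both vanish at t = 0,
    and in characteristic 0 a linear problem dV/dt = JV A + B V with V = 0 at t = 0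
    has only the zero solution, by induction on the order in t. The difference of
    two solutions of the Cauchy problem solves such a linear problem too. *)

Require Import Defs.
From HB Require Import structures.
From mathcomp Require Import all_boot all_order all_algebra.
From mathcomp Require Import mpoly.
From mathcomp Require Import boolp constructive_ereal reals complex.

Set Implicit Arguments.
Unset Strict Implicit.
Unset Printing Implicit Defensive.

Import Order.TTheory GRing.Theory Num.Theory.
Local Open Scope ring_scope.

(** * Order and partial derivatives of power series *)

Section PowerSeries.
Variables (R : comNzRingType) (n : nat).
Implicit Types (f g : {fps R[n]}) (m : 'X_{1..n}) (d : nat).

Lemma fps_addE f g m : (f + g) m = f m + g m.
Proof. by []. Qed.

Lemma fps_sumE (I : Type) (r : seq I) (P : pred I) (F : I -> {fps R[n]}) m :
  (\sum_(i <- r | P i) F i) m = \sum_(i <- r | P i) F i m.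
Proof. by elim/big_rec2: _ => // i x y _ <-. Qed.

Lemma fps_coefM f g m :
  (f * g) m = (fps_trunc (mdeg m).+1 f * fps_trunc (mdeg m).+1 g)@_m.
Proof. exact: fps_mulE. Qed.

Lemma fpsCM a f m : (fpsC n a * f) m = a * f m.
Proof.
rewrite fps_coefM (mcoeffM_eq (p' := a%:MP) (q' := fps_trunc (mdeg m).+1 f)) //.
  by rewrite mcoeffCM mcoeff_fps_trunc.
by move=> k km; rewrite mcoeff_fps_trunc // mcoeffC mulr_natr.
Qed.

Fact fpsC_additive : zmod_morphism (@fpsC R n).
Proof. by move=> a b; apply: fpsP => m /=; rewrite mulrnBl. Qed.

Fact fpsC_multiplicative : monoid_morphism (@fpsC R n).
Proof.
by split=> [//|a b]; apply: fpsP => m; rewrite fpsCM /= mulrnAr.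
Qed.

HB.instance Definition _ :=
  GRing.isZmodMorphism.Build R {fps R[n]} (@fpsC R n) fpsC_additive.
HB.instance Definition _ :=
  GRing.isMonoidMorphism.Build R {fps R[n]} (@fpsC R n) fpsC_multiplicative.

(** Working form of the bound [d <= fps_order f]: stated on coefficients, it treats the zero series
    like any other. *)
Definition order_ge d f := forall m, (mdeg m < d)%N -> f m = 0.

Lemma order_ge0 f : order_ge 0 f.
Proof. by []. Qed.

Lemma order_geW d e f : (e <= d)%N -> order_ge d f -> order_ge e f.
Proof. by move=> le fd m lt; apply: fd; apply: leq_trans le. Qed.

Lemma order_geD d f g : order_ge d f -> order_ge d g -> order_ge d (f + g).
Proof. by move=> fd gd m lt; rewrite /= fd // gd // addr0. Qed.

Lemma order_ge_sum d (I : Type) (r : seq I) (P : pred I) (F : I -> {fps R[n]}) :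
  (forall i, P i -> order_ge d (F i)) -> order_ge d (\sum_(i <- r | P i) F i).
Proof. by move=> Fd m lt; rewrite fps_sumE big1 // => i /Fd; apply. Qed.

Lemma order_geM d e f g :
  order_ge d f -> order_ge e g -> order_ge (d + e) (f * g).
Proof.
move=> fd ge m lt; apply: big1 => -[k1 k2] /= /eqP mE.
have [/fd ->|le1] := ltnP (mdeg k1) d; first by rewrite mul0r.
rewrite ge ?mulr0 // ltnNge; apply/negP => le2.
by move: lt; rewrite mE mdegD ltnNge leq_add.
Qed.

Lemma order_geMl d f g : order_ge d g -> order_ge d (f * g).
Proof. by move=> gd; apply: (order_geM (@order_ge0 f) gd). Qed.

Lemma order_geX d e f : order_ge d f -> order_ge (d * e) (f ^+ e).
Proof.
move=> fd; elim: e => [|e IH]; first by rewrite muln0.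
by rewrite exprS mulnS; apply: order_geM.
Qed.

Lemma order_ge_prod (I : Type) (r : seq I) (e : I -> nat) (F : I -> {fps R[n]}) :
  (forall i, order_ge (e i) (F i)) ->
  order_ge (\sum_(i <- r) e i) (\prod_(i <- r) F i).
Proof.
by move=> Fd; elim/big_rec2: _ => // i d f _ fd; apply: order_geM.
Qed.

Lemma order_ge_deriv d i f : order_ge d f -> order_ge d.-1 (fps_deriv i f).
Proof.
move=> fd m lt /=; rewrite fd ?mul0rn // mdegD mdeg1 addn1.
by case: d fd lt.
Qed.

(** Differentiation lowers degrees by one, so the truncation must reach one degree further than the
    coefficients sought. *)
Lemma fps_deriv_trunc d i f m : (mdeg m < d)%N ->
  fps_deriv i f m = ((fps_trunc d.+1 f)^`M(i))@_m.
Proof.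
by move=> md; rewrite mcoeff_deriv mcoeff_fps_trunc // mdegD mdeg1 addn1.
Qed.

Fact fps_deriv_additive i : zmod_morphism (@fps_deriv R n i).
Proof. by move=> f g; apply: fpsP => m /=; rewrite mulrnBl. Qed.

HB.instance Definition _ i :=
  GRing.isZmodMorphism.Build {fps R[n]} {fps R[n]} (@fps_deriv R n i)
    (fps_deriv_additive i).

(** The coefficient at m involves only terms of degree at most [(mdeg m).+1], so the Leibniz rule is
    inherited from polynomial truncations. *)
Lemma fps_derivM i f g :
  fps_deriv i (f * g) = fps_deriv i f * g + f * fps_deriv i g.
Proof.
apply: fpsP => m; set d := (mdeg m).+1.
have lt k : (mdeg k <= mdeg m)%N -> (mdeg k < d)%N by [].
transitivity ((fps_trunc d.+1 f * fps_trunc d.+1 g)^`M(i))@_m.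
  rewrite mcoeff_deriv /= -(@fps_mulE _ _ d.+1) //.
  by rewrite mdegD mdeg1 addn1.
rewrite mderivM mcoeffD.
(* By commutativity, both summands of the Leibniz rule are instances of this one identity. *)
suff e (h k : {fps R[n]}) : ((fps_trunc d.+1 h)^`M(i) * fps_trunc d.+1 k)@_m
               = (fps_deriv i h * k) m.
  by rewrite e [X in _ + X@__]mulrC e [fps_deriv i g * f]mulrC.
rewrite fps_coefM; apply: mcoeffM_eq => l le.
  by rewrite mcoeff_fps_trunc // -fps_deriv_trunc ?lt.
by rewrite !mcoeff_fps_trunc // ltnW // !ltnS.
Qed.

Lemma fps_derivC i (a : R) : fps_deriv i (fpsC n a) = 0.
Proof. by apply: fpsP => m /=; rewrite mnmD_eq0 mnm1_eq0 andbF mulr0n mul0rn. Qed.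

Lemma fps_derivX i j : fps_deriv i (fpsX R j) = (i == j)%:R :> {fps R[n]}.
Proof.
apply: fpsP => m.
have -> : ((i == j)%:R : {fps R[n]}) m = (m == 0%MM)%:R *+ (i == j).
  by case: (i == j).
rewrite /=; case: (eqVneq i j) => [<-|nij].
  rewrite -{2}[U_(i)%MM]add0m eqm_add2r.
  case: eqVneq => [->|_]; last by rewrite mul0rn.
  by rewrite mnm0E.
case: eqVneq => [/mnmP/(_ i)|_]; last by rewrite mul0rn.
by rewrite mnmDE !mnm1E eqxx eq_sym (negPf nij) addn1.
Qed.

End PowerSeries.

(** * Substitution of formal maps and the chain rule *)

Section Composition.
Variables (R : comNzRingType) (k n : nat).
Implicit Types (f g : {fps R[k]}) (G : 'cV[{fps R[n]}]_k) (m : 'X_{1..n}).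

(** Substitution into a polynomial, a ring morphism by construction; identities for [fps_comp] are
    proved by comparing the two coefficient by coefficient. *)
Definition fps_eval G (p : {mpoly R[k]}) : {fps R[n]} :=
  mmap (@fpsC R n) (fun i => G i 0) p.

HB.instance Definition _ G := GRing.RMorphism.copy (fps_eval G)
  (mmap (@fpsC R n) (fun i => G i 0)).

Lemma fps_evalX G i : fps_eval G 'X_i = G i 0.
Proof. by rewrite /fps_eval mmapX mmap1U. Qed.

Lemma fps_evalZ G a p : fps_eval G (a *: p) = fpsC n a * fps_eval G p.
Proof. by rewrite -mul_mpolyC rmorphM /= /fps_eval mmapC. Qed.

Lemma fps_eval_trunc G d f :
  fps_eval G (fps_trunc d f) =
  \sum_(a : 'X_{1..k < d}) fpsC n (f a) * fps_eval G 'X_[a].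
Proof. by rewrite rmorph_sum /=; apply: eq_bigr => a _; rewrite fps_evalZ. Qed.

Lemma order_ge_eval G d (p : {mpoly R[k]}) : (forall i, order_ge 1 (G i 0)) ->
  (forall a, (mdeg a < d)%N -> p@_a = 0) -> order_ge d (fps_eval G p).
Proof.
move=> G1 p0; apply: order_ge_sum => a _.
have [/p0 -> m _|le] := ltnP (mdeg a) d; first by rewrite rmorph0 mul0r.
apply/order_geMl/(order_geW le); rewrite mdegE.
by apply: order_ge_prod => i; have := order_geX (e := a i) (G1 i); rewrite mul1n.
Qed.

(** A polynomial vanishing through degree [mdeg m] evaluates at G to a series of order above
    [mdeg m]. Hence any approximation p of f, not just a truncation, computes this coefficient. *)
Lemma fps_compE G f (p : {mpoly R[k]}) m : (forall i, order_ge 1 (G i 0)) ->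
  (forall a, (mdeg a <= mdeg m)%N -> p@_a = f a) ->
  fps_comp f G m = fps_eval G p m.
Proof.
move=> G1 pf; set q := fps_trunc (mdeg m).+1 f.
have -> : fps_comp f G m = fps_eval G q m.
  rewrite fps_eval_trunc fps_sumE; apply: eq_bigr => a _.
  by rewrite fpsCM /fps_eval mmapX.
have: order_ge (mdeg m).+1 (fps_eval G (q - p)).
  by apply: order_ge_eval => // a le; rewrite mcoeffB mcoeff_fps_trunc ?pf ?subrr.
by move/(_ m (leqnn _))/eqP; rewrite rmorphB /= subr_eq0 => /eqP.
Qed.

Lemma fps_compD G f g : fps_comp (f + g) G = fps_comp f G + fps_comp g G.
Proof.
apply: fpsP => m /=; rewrite -big_split /=.
by apply: eq_bigr => a _; rewrite mulrDl.
Qed.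

Lemma fps_compB G f g : fps_comp (f - g) G = fps_comp f G - fps_comp g G.
Proof.
apply: fpsP => m /=; rewrite -sumrB.
by apply: eq_bigr => a _; rewrite mulrBl.
Qed.

Lemma fps_compCM G a f : fps_comp (fpsC k a * f) G = fpsC n a * fps_comp f G.
Proof.
apply: fpsP => m; rewrite fpsCM mulr_sumr; apply: eq_bigr => b _.
by rewrite fpsCM mulrA.
Qed.

Lemma fps_compX G i : (forall i, order_ge 1 (G i 0)) ->
  fps_comp (fpsX R i) G = G i 0.
Proof.
move=> G1; apply: fpsP => m; rewrite (fps_compE (p := 'X_i)) ?fps_evalX // => a _.
by rewrite mcoeffX eq_sym.
Qed.

(* Covers both the derivations d/dz_j (with theta = 0) and d/dt (with theta the
   derivation of the coefficient ring). *)
Section ChainRule.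
Variables (theta : R -> R) (delta : {additive {fps R[n]} -> {fps R[n]}}).
Hypothesis deltaM : forall f g : {fps R[n]},
  delta (f * g) = delta f * g + f * delta g.
Hypothesis deltaC : forall a, delta (fpsC n a) = fpsC n (theta a).
Hypothesis delta_order : forall d (f : {fps R[n]}),
  order_ge d f -> order_ge d.-1 (delta f).

(** The chain rule without a [theta] term, as is right for monomials: their coefficient 1 is killed
    by [delta]. *)
Let derivable G (p : {mpoly R[k]}) :=
  delta (fps_eval G p) = \sum_i fps_eval G (p^`M(i)) * delta (G i 0).

Let derivableM G p q : derivable G p -> derivable G q -> derivable G (p * q).
Proof.
rewrite /derivable rmorphM deltaM => /= -> ->.
rewrite mulr_suml mulr_sumr -big_split /=; apply: eq_bigr => i _.
by rewrite mderivM rmorphD !rmorphM /= mulrDl mulrAC mulrA.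
Qed.

Let derivable1 G : derivable G 1.
Proof.
rewrite /derivable rmorph1 big1 => [|i _].
  (* Leibniz on 1 * 1 gives delta 1 = delta 1 + delta 1, hence delta 1 = 0. *)
  by have := deltaM 1 1; rewrite !(mulr1, mul1r) -[LHS]addr0 => /addrI.
by rewrite -mpolyC1 mderivC rmorph0 mul0r.
Qed.

Let derivable_var G i : derivable G 'X_i.
Proof.
rewrite /derivable fps_evalX (bigD1 i) //= big1 => [|j ji]; last first.
  by rewrite mderivX mnm1E eq_sym (negPf ji) scale0r rmorph0 mul0r.
rewrite mderivX mnm1E eqxx scale1r -{1}[U_(i)%MM]add0m addmK mpolyX0.
by rewrite rmorph1 mul1r addr0.
Qed.

Let derivable_monom G a : derivable G 'X_[a].
Proof.
rewrite mpolyXE_id; elim/big_ind: _ => [|p q|i _].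
- exact: derivable1.
- exact: derivableM.
elim: (a i) => [|e IH]; first exact: derivable1.
by rewrite exprS; apply: derivableM (derivable_var _ _) IH.
Qed.

(** Leibniz carries the rule from variables to monomials, and additivity with [deltaC] to
    polynomials. The loss of at most one order under [delta] lets truncations decide each
    coefficient. *)
Lemma fps_chain_rule f G : (forall i, order_ge 1 (G i 0)) ->
  delta (fps_comp f G) = fps_comp (fps_map theta f) G
    + \sum_i fps_comp (fps_deriv i f) G * delta (G i 0).
Proof.
move=> G1; apply: fpsP => m; set d := (mdeg m).+1; set p := fps_trunc d.+1 f.
(* The truncation error has order at least [d.+1]; after [delta] its order is still at least d,
   which exceeds [mdeg m]. *)
have -> : delta (fps_comp f G) m = delta (fps_eval G p) m.
  apply/eqP; rewrite -subr_eq0; apply/eqP.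
  rewrite -[LHS]/((delta (fps_comp f G) - delta (fps_eval G p)) m) -raddfB.
  apply: (@delta_order d.+1) => // l ld.
  by rewrite /= -(@fps_compE G f p) ?subrr // => a le;
    rewrite mcoeff_fps_trunc // (leq_ltn_trans le).
have -> : delta (fps_eval G p) = fps_eval G (fps_trunc d.+1 (fps_map theta f))
    + \sum_i fps_eval G (p^`M(i)) * delta (G i 0).
  rewrite /p !fps_eval_trunc raddf_sum /=.
  under eq_bigr do rewrite deltaM deltaC derivable_monom.
  rewrite big_split /=; congr (_ + _).
  under eq_bigr do rewrite mulr_sumr.
  rewrite exchange_big /=; apply: eq_bigr => i _.
  rewrite (raddf_sum (mderiv i)) rmorph_sum mulr_suml /=; apply: eq_bigr => a _.
  by rewrite mderivZ fps_evalZ mulrA.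
rewrite !fps_addE; congr (_ + _).
  rewrite -(@fps_compE G (fps_map theta f)) // => a le.
  by rewrite mcoeff_fps_trunc // ltnW.
rewrite !fps_sumE; apply: eq_bigr => i _.
(* The product's coefficient at m uses the left factor only at [k1] of degree at most [mdeg m],
   where p is accurate even after one derivative. *)
apply: eq_bigr => -[k1 k2] /= _; congr (_ * _).
rewrite -(@fps_compE G (fps_deriv i f)) // => a le.
by rewrite -fps_deriv_trunc // ltnS (leq_trans le) // -ltnS; case: (k1).
Qed.

End ChainRule.

Lemma fps_deriv_comp j f G : (forall i, order_ge 1 (G i 0)) ->
  fps_deriv j (fps_comp f G) =
  \sum_i fps_comp (fps_deriv i f) G * fps_deriv j (G i 0).
Proof.
move=> G1; rewrite (@fps_chain_rule (fun=> 0)) //.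
- rewrite -[RHS]add0r; congr (_ + _); apply: fpsP => m /=.
  by rewrite big1 // => a _; rewrite mul0r.
- exact: fps_derivM.
- by move=> a; rewrite /= fps_derivC rmorph0.
- by move=> d g; apply: order_ge_deriv.
Qed.

End Composition.

(** * The identity map and products under substitution *)

Section CompositionIdentity.
Variables (R : comNzRingType) (n : nat).

Definition fps_of_mpoly (p : {mpoly R[n]}) : {fps R[n]} := FPS (fun m => p@_m).

Fact fps_of_mpoly_additive : zmod_morphism fps_of_mpoly.
Proof. by move=> p q; apply: fpsP => m; rewrite /= mcoeffB. Qed.

Fact fps_of_mpoly_multiplicative : monoid_morphism fps_of_mpoly.
Proof.
split=> [|p q]; apply: fpsP => m; first by rewrite /= mcoeff1.
by rewrite fps_coefM; apply: mcoeffM_eq => k km; rewrite mcoeff_fps_trunc.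
Qed.

HB.instance Definition _ := GRing.isZmodMorphism.Build {mpoly R[n]} {fps R[n]}
  fps_of_mpoly fps_of_mpoly_additive.
HB.instance Definition _ := GRing.isMonoidMorphism.Build {mpoly R[n]} {fps R[n]}
  fps_of_mpoly fps_of_mpoly_multiplicative.

Lemma order_ge_fpsX i : order_ge 1 (fpsX R i : {fps R[n]}).
Proof.
move=> m; rewrite ltnS leqn0 mdeg_eq0 => /eqP -> /=.
by rewrite eq_sym mnm1_eq0.
Qed.

(** Evaluation at the variables agrees with the embedding [fps_of_mpoly] on monomials, hence on
    every truncation of f. *)
Lemma fps_comp_id (f : {fps R[n]}) : fps_comp f (fmap_id R n) = f.
Proof.
apply: fpsP => m; rewrite (fps_compE (p := fps_trunc (mdeg m).+1 f)).
- rewrite -[RHS](mcoeff_fps_trunc f (leqnn _)).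
  rewrite -[RHS]/(fps_of_mpoly _ m); congr (fcoef _ m).
  rewrite fps_eval_trunc /fps_trunc raddf_sum; apply: eq_bigr => a _ /=.
  have -> : fps_of_mpoly (f a *: 'X_[a]) = fpsC n (f a) * fps_of_mpoly 'X_[a].
    by apply: fpsP => b; rewrite fpsCM /= mcoeffZ.
  congr (_ * _); rewrite [in RHS]mpolyXE_id rmorph_prod /fps_eval mmapX.
  apply: eq_bigr => i _; rewrite mxE rmorphXn; congr (_ ^+ _).
  by apply: fpsP => b; rewrite /= mcoeffX eq_sym.
- by move=> i; rewrite mxE; apply: order_ge_fpsX.
by move=> a le; rewrite mcoeff_fps_trunc.
Qed.

End CompositionIdentity.

(** Polynomial evaluation is multiplicative, and the product of two truncations is correct through
    degree [mdeg m], although it is not itself a truncation of f * g. *)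
Lemma fps_compM (R : comNzRingType) (k n : nat) (f g : {fps R[k]})
    (G : 'cV[{fps R[n]}]_k) : (forall i, order_ge 1 (G i 0)) ->
  fps_comp (f * g) G = fps_comp f G * fps_comp g G.
Proof.
move=> G1; apply: fpsP => m; set d := (mdeg m).+1.
rewrite (fps_compE (p := fps_trunc d f * fps_trunc d g)) // => [|a le].
  rewrite rmorphM /=; apply: eq_bigr => -[k1 k2] /= _; congr (_ * _).
    by rewrite -(@fps_compE _ _ _ G f) // => a le;
      rewrite mcoeff_fps_trunc // (leq_ltn_trans le) // bmdeg.
  by rewrite -(@fps_compE _ _ _ G g) // => a le;
      rewrite mcoeff_fps_trunc // (leq_ltn_trans le) // bmdeg.
by rewrite -(@fps_mulE _ _ d).
Qed.

(** * Change of the coefficient ring *)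

Section CoefficientMorphism.
Variables (R S : comNzRingType) (phi : {rmorphism R -> S}) (n : nat).
Implicit Types f g : {fps R[n]}.

Fact fps_map_additive : zmod_morphism (@fps_map R S n phi).
Proof. by move=> f g; apply: fpsP => m; rewrite /= rmorphB. Qed.

Fact fps_map_multiplicative : monoid_morphism (@fps_map R S n phi).
Proof.
split=> [|f g]; apply: fpsP => m; first by rewrite /= rmorph_nat.
by rewrite /= rmorph_sum; apply: eq_bigr => a _; rewrite rmorphM.
Qed.

HB.instance Definition _ := GRing.isZmodMorphism.Build {fps R[n]} {fps S[n]}
  (@fps_map R S n phi) fps_map_additive.
HB.instance Definition _ := GRing.isMonoidMorphism.Build {fps R[n]} {fps S[n]}
  (@fps_map R S n phi) fps_map_multiplicative.

Lemma fps_mapC a : fps_map phi (fpsC n a) = fpsC n (phi a).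
Proof. by apply: fpsP => m; rewrite /= rmorphMn. Qed.

Lemma fps_mapX i : fps_map phi (fpsX R i) = fpsX S i :> {fps S[n]}.
Proof. by apply: fpsP => m; rewrite /= rmorph_nat. Qed.

Lemma fps_map_deriv i f :
  fps_map phi (fps_deriv i f) = fps_deriv i (fps_map phi f).
Proof. by apply: fpsP => m; rewrite /= rmorphMn. Qed.

Lemma order_ge_map d f : order_ge d f -> order_ge d (fps_map phi f).
Proof. by move=> fd m lt; rewrite /= fd ?rmorph0. Qed.

Lemma fps_map_comp k (f : {fps R[k]}) (G : 'cV[{fps R[n]}]_k) :
  fps_map phi (fps_comp f G) =
  fps_comp (fps_map phi f) (map_mx (fps_map phi) G).
Proof.
apply: fpsP => m; rewrite /= rmorph_sum; apply: eq_bigr => a _.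
rewrite rmorphM; congr (_ * _).
rewrite -[LHS]/(fps_map phi _ m) rmorph_prod; congr (fcoef _ m).
by apply: eq_bigr => i _; rewrite rmorphXn mxE.
Qed.

Lemma map_fmap_id : map_mx (fps_map phi) (fmap_id R n) = fmap_id S n.
Proof. by apply/colP => i; rewrite !mxE fps_mapX. Qed.

Lemma map_fmap_comp l k (F : 'cV[{fps R[k]}]_l) (G : 'cV[{fps R[n]}]_k) :
  map_mx (fps_map phi) (fmap_comp F G) =
  fmap_comp (map_mx (fps_map phi) F) (map_mx (fps_map phi) G).
Proof. by apply/colP => i; rewrite !mxE fps_map_comp. Qed.

End CoefficientMorphism.

(** * Jacobians and composition of formal maps *)

Section Jacobian.
Variable R : comNzRingType.

Lemma jacobianD n k (U V : 'cV[{fps R[n]}]_k) :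
  jacobian (U + V) = jacobian U + jacobian V.
Proof. by apply/matrixP => i j; rewrite !mxE raddfD. Qed.

Lemma jacobianB n k (U V : 'cV[{fps R[n]}]_k) :
  jacobian (U - V) = jacobian U - jacobian V.
Proof. by apply/matrixP => i j; rewrite !mxE raddfB. Qed.

Lemma jacobianZ n k a (U : 'cV[{fps R[n]}]_k) :
  jacobian (fpsC n a *: U) = fpsC n a *: jacobian U.
Proof.
by apply/matrixP => i j; rewrite !mxE fps_derivM fps_derivC mul0r add0r.
Qed.

Lemma jacobian_id n : jacobian (fmap_id R n) = 1%:M.
Proof. by apply/matrixP => i j; rewrite !mxE fps_derivX eq_sym. Qed.

Lemma jacobian_comp l k n (F : 'cV[{fps R[k]}]_l) (G : 'cV[{fps R[n]}]_k) :
  (forall i, order_ge 1 (G i 0)) ->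
  jacobian (fmap_comp F G) =
  map_mx (fun f => fps_comp f G) (jacobian F) *m jacobian G.
Proof.
move=> G1; apply/matrixP => i j; rewrite !mxE fps_deriv_comp //.
by apply: eq_bigr => a _; rewrite !mxE.
Qed.

Lemma fmap_comp_mulmx k n (A : 'M[{fps R[k]}]_k) (U : 'cV[{fps R[k]}]_k)
    (G : 'cV[{fps R[n]}]_k) : (forall i, order_ge 1 (G i 0)) ->
  fmap_comp (A *m U) G = map_mx (fun f => fps_comp f G) A *m fmap_comp U G.
Proof.
move=> G1; apply/colP => i; rewrite !mxE.
have comp0 : fps_comp 0 G = 0.
  by apply: fpsP => m /=; rewrite big1 // => a _; rewrite mul0r.
rewrite (big_morph (fun f => fps_comp f G) (id1 := 0) (op1 := +%R)) //.
  by apply: eq_bigr => a _; rewrite !mxE fps_compM.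
by move=> f g; apply: fps_compD.
Qed.

Lemma fmap_comp_id n k (F : 'cV[{fps R[n]}]_k) : fmap_comp F (fmap_id R n) = F.
Proof. by apply/colP => i; rewrite mxE fps_comp_id. Qed.

Lemma id_fmap_comp n k (G : 'cV[{fps R[n]}]_k) : (forall i, order_ge 1 (G i 0)) ->
  fmap_comp (fmap_id R k) G = G.
Proof. by move=> G1; apply/colP => i; rewrite !mxE fps_compX. Qed.

Lemma fmap_compD l k n (F F' : 'cV[{fps R[k]}]_l) (G : 'cV[{fps R[n]}]_k) :
  fmap_comp (F + F') G = fmap_comp F G + fmap_comp F' G.
Proof. by apply/colP => i; rewrite !mxE fps_compD. Qed.

Lemma fmap_compB l k n (F F' : 'cV[{fps R[k]}]_l) (G : 'cV[{fps R[n]}]_k) :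
  fmap_comp (F - F') G = fmap_comp F G - fmap_comp F' G.
Proof. by apply/colP => i; rewrite !mxE fps_compB. Qed.

Lemma fmap_compZ l k n a (F : 'cV[{fps R[k]}]_l) (G : 'cV[{fps R[n]}]_k) :
  fmap_comp (fpsC k a *: F) G = fpsC n a *: fmap_comp F G.
Proof. by apply/colP => i; rewrite !mxE fps_compCM. Qed.

(** Admits both z + tN and z - tH as inner maps of a composition. *)
Lemma order_ge_deformation n a (U : 'cV[{fps R[n]}]_n) :
  (forall i, order_ge 1 (U i 0)) ->
  forall i, order_ge 1 ((fmap_id R n + fpsC n a *: U) i 0).
Proof.
move=> U1 i; rewrite !mxE; apply: order_geD; first exact: order_ge_fpsX.
exact: order_geMl.
Qed.

End Jacobian.

(** * The embedding of K[t] into K[[t]] *)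

Section PolynomialsAsSeries.
Variable K : comNzRingType.
Implicit Types p q : {poly K}.

(** Factors the embedding through evaluation at the variable in [{mpoly K[1]}], so that
    multiplicativity follows from that of each factor. *)
Lemma poly_fpsE p :
  poly_fps p = fps_of_mpoly (map_poly (@mpolyC 1 K) p).['X_ord0].
Proof.
apply: fpsP => m /=; rewrite horner_coef raddf_sum /=.
have XE i : ('X_ord0 ^+ i : {mpoly K[1]})@_m = (i == m ord0)%:R.
  rewrite mpolyXn mcoeffX; congr (_%:R); congr nat_of_bool.
  apply/eqP/eqP => [<-|->]; first by rewrite mulmnE mnm1E mul1n.
  by apply/mnmP => j; rewrite mulmnE mnm1E (ord1 j) eqxx mul1n.
under eq_bigr do rewrite coef_map /= mcoeffCM XE.
have [lt|ge] := ltnP (m ord0) (size (map_poly (@mpolyC 1 K) p)).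
  rewrite (bigD1 (Ordinal lt)) //= eqxx mulr1 big1 ?addr0 // => i ne.
  by rewrite [_ == _](negPf ne) mulr0.
rewrite big1 => [|i _]; last first.
  by rewrite ltn_eqF ?mulr0 // (leq_trans _ ge).
(* Past the size the mapped coefficient is the default 0; its constant term is the coefficient of p,
   which therefore vanishes. *)
have := congr1 (mcoeff 0%MM) (nth_default 0 ge).
by rewrite -/(_`_(m ord0)) coef_map /= mcoeffC eqxx mulr1 mcoeff0.
Qed.

Fact poly_fps_additive : zmod_morphism (@poly_fps K).
Proof. by move=> p q; apply: fpsP => m; rewrite /= coefB. Qed.

Fact poly_fps_multiplicative : monoid_morphism (@poly_fps K).
Proof.
split=> [|p q]; rewrite !poly_fpsE; first by rewrite rmorph1 hornerC rmorph1.
by rewrite rmorphM hornerM rmorphM.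
Qed.

HB.instance Definition _ := GRing.isZmodMorphism.Build {poly K} {fps K[1]}
  (@poly_fps K) poly_fps_additive.
HB.instance Definition _ := GRing.isMonoidMorphism.Build {poly K} {fps K[1]}
  (@poly_fps K) poly_fps_multiplicative.

Lemma mnm1_eq (a b : 'X_{1..1}) : (a == b) = (a ord0 == b ord0).
Proof.
apply/eqP/eqP => [-> //|e]; apply/mnmP => i; by rewrite (ord1 i).
Qed.

Lemma poly_fps_inj : injective (@poly_fps K).
Proof.
move=> p q pq; apply/polyP => i.
by have := congr1 (fun f => fcoef f [multinom i | _ < 1]) pq; rewrite /= mnmE.
Qed.

Lemma poly_fpsC (a : K) : poly_fps a%:P = fpsC 1 a.
Proof.
by apply: fpsP => m; rewrite /= coefC mnm1_eq mnm0E; case: eqP.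
Qed.

Lemma poly_fpsX : poly_fps 'X = fpsX K ord0.
Proof. by apply: fpsP => m; rewrite /= coefX mnm1_eq mnm1E. Qed.

End PolynomialsAsSeries.

(** * Evaluation at the origin *)

Section ConstantTerm.
Variable K : comNzRingType.

(** For n = 1 this is the map underlying [fmap_t0]; as a ring morphism it makes setting t = 0
    commute with composition. *)
Definition fps_ev0 n (f : {fps K[n]}) : K := f 0%MM.

Fact fps_ev0_additive n : zmod_morphism (@fps_ev0 n).
Proof. by []. Qed.

Fact fps_ev0_multiplicative n : monoid_morphism (@fps_ev0 n).
Proof.
split=> [|f g]; rewrite /fps_ev0; first by rewrite /= eqxx.
by rewrite fps_coefM mdeg0 rmorphM /= !mcoeff_fps_trunc // mdeg0.
Qed.

HB.instance Definition _ n := GRing.isZmodMorphism.Build {fps K[n]} K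
  (@fps_ev0 n) (@fps_ev0_additive n).
HB.instance Definition _ n := GRing.isMonoidMorphism.Build {fps K[n]} K
  (@fps_ev0 n) (@fps_ev0_multiplicative n).

End ConstantTerm.

(** * Differentiation in the parameter t *)

Section ParameterDerivation.
Variables (K : comNzRingType) (n : nat).
Local Notation S := {fps K[1]}.
Implicit Types (f g : {fps S[n]}) (U V : 'cV[{fps S[n]}]_n).

Definition fps_dt f : {fps S[n]} := fps_map (fps_deriv ord0) f.

Fact fps_dt_additive : zmod_morphism fps_dt.
Proof. by move=> f g; apply: fpsP => m; rewrite /= raddfB. Qed.

HB.instance Definition _ :=
  GRing.isZmodMorphism.Build {fps S[n]} {fps S[n]} fps_dt fps_dt_additive.

Lemma fps_dtM f g : fps_dt (f * g) = fps_dt f * g + f * fps_dt g.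
Proof.
apply: fpsP => m; rewrite /= raddf_sum -big_split /=.
by apply: eq_bigr => a _; rewrite fps_derivM.
Qed.

Lemma fps_dtC a : fps_dt (fpsC n a) = fpsC n (fps_deriv ord0 a).
Proof. by apply: fpsP => m; rewrite /= raddfMn. Qed.

Lemma fps_dt_order d f : order_ge d f -> order_ge d (fps_dt f).
Proof. by move=> fd m lt; rewrite /= fd ?raddf0. Qed.

Lemma fmap_dtB U V : fmap_dt (U - V) = fmap_dt U - fmap_dt V.
Proof. by apply/colP => i; rewrite !mxE -[LHS]/(fps_dt _) raddfB. Qed.

Lemma fmap_dtD U V : fmap_dt (U + V) = fmap_dt U + fmap_dt V.
Proof. by apply/colP => i; rewrite !mxE -[LHS]/(fps_dt _) raddfD. Qed.

Lemma fmap_dt_tZ U :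
  fmap_dt (fpsC n (fpsX K ord0) *: U) = U + fpsC n (fpsX K ord0) *: fmap_dt U.
Proof.
apply/colP => i; rewrite !mxE -[LHS]/(fps_dt _) fps_dtM fps_dtC fps_derivX.
by rewrite rmorph1 mul1r.
Qed.

Lemma fmap_dt_id : fmap_dt (fmap_id S n) = 0.
Proof.
apply/colP => i; rewrite !mxE; apply: fpsP => m /=.
by case: (m == _)%MM; rewrite ?raddf0 // -(rmorph1 (@fpsC K 1)) fps_derivC.
Qed.

(** [fps_chain_rule] for d/dt: t occurs both in the coefficients of F and in the inner map G, whence
    the two summands. *)
Lemma fmap_dt_comp (F G : 'cV[{fps S[n]}]_n) : (forall i, order_ge 1 (G i 0)) ->
  fmap_dt (fmap_comp F G) = fmap_comp (fmap_dt F) G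
    + map_mx (fun f => fps_comp f G) (jacobian F) *m fmap_dt G.
Proof.
move=> G1; apply/colP => i; rewrite !mxE -[LHS]/(fps_dt _).
rewrite (@fps_chain_rule _ _ _ (fps_deriv ord0)) //.
- by congr (_ + _); apply: eq_bigr => j _; rewrite !mxE.
- exact: fps_dtM.
- exact: fps_dtC.
by move=> d f fd; apply/fps_dt_order/(order_geW _ fd)/leq_pred.
Qed.

End ParameterDerivation.

(** * Order in t and uniqueness for linear problems *)

Section TAdic.
Variables (K : numDomainType) (n : nat).
Local Notation S := {fps K[1]}.
Implicit Types (f g : {fps S[n]}) (d : nat).

(** Divisibility by the d-th power of t. Unlike the order in z, it survives differentiation in z. *)
Definition t_order_ge d f := forall m, order_ge d (f m).

Lemma t_order_geD d f g :
  t_order_ge d f -> t_order_ge d g -> t_order_ge d (f + g).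
Proof. by move=> fd gd m; apply: order_geD. Qed.

Lemma t_order_ge_sum d (I : Type) (r : seq I) (P : pred I) (F : I -> {fps S[n]}) :
  (forall i, P i -> t_order_ge d (F i)) -> t_order_ge d (\sum_(i <- r | P i) F i).
Proof. by move=> Fd m; rewrite fps_sumE; apply: order_ge_sum => i /Fd. Qed.

Lemma t_order_geMl d f g : t_order_ge d g -> t_order_ge d (f * g).
Proof. by move=> gd m; apply: order_ge_sum => a _; apply: order_geMl. Qed.

Lemma t_order_geMr d f g : t_order_ge d f -> t_order_ge d (f * g).
Proof. by rewrite mulrC; apply: t_order_geMl. Qed.

Lemma t_order_ge_deriv d i f : t_order_ge d f -> t_order_ge d (fps_deriv i f).
Proof.
by move=> fd m /=; rewrite -mulr_natl; apply: order_geMl.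
Qed.

Lemma t_order_ge_eq0 f : (forall d, t_order_ge d f) -> f = 0.
Proof.
by move=> f0; apply: fpsP => m; apply: fpsP => a; apply: (f0 (mdeg a).+1).
Qed.

(** Away from the constant term, each coefficient of a times its nonzero exponent is a coefficient
    of the derivative one degree lower; characteristic 0 removes the factor. *)
Lemma order_ge_antideriv d (a : S) :
  a 0%MM = 0 -> order_ge d (fps_deriv ord0 a) -> order_ge d.+1 a.
Proof.
move=> a0 ad m; have [->//|m0] := eqVneq m 0%MM.
have le : (U_(ord0) <= m)%MM.
  apply/mnm_lepP => i; rewrite (ord1 i) mnm1E eqxx lt0n.
  by apply: contra_neq m0 => e; apply/eqP; rewrite mnm1_eq mnm0E e.
rewrite -(submK le) mdegD mdeg1 addn1 ltnS => /ad /= /eqP.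
by rewrite mulrn_eq0 => /eqP.
Qed.

(** If t^d divides V, it divides JV and the whole right-hand side, hence dV/dt; integrating from the
    value 0 at t = 0 gives divisibility by t^(d+1). *)
Lemma cauchy_linear_unique (V A : 'cV[{fps S[n]}]_n) (B : 'M[{fps S[n]}]_n) :
  fmap_dt V = jacobian V *m A + B *m V -> fmap_t0 V = 0 -> V = 0.
Proof.
move=> Vt V0.
have V_ge d : forall i, t_order_ge d (V i 0).
  elim: d => [|d IH] i m; first by [].
  apply: order_ge_antideriv.
    by have /colP/(_ i) := V0; rewrite !mxE => /(congr1 (fun h : {fps K[n]} => h m)).
  have /colP/(_ i) := Vt; rewrite !mxE => /(congr1 (fun h : {fps S[n]} => h m)) /= ->.
  have : t_order_ge d (\sum_j jacobian V i j * A j 0 + \sum_j B i j * V j 0).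
    apply: t_order_geD; apply: t_order_ge_sum => j _; last exact: t_order_geMl.
    by rewrite mxE; apply/t_order_geMr/t_order_ge_deriv.
  exact.
by apply/colP => i; rewrite mxE; apply: t_order_ge_eq0 => d.
Qed.

(** Each use of the equation gains one factor t, so V is divisible by every power of t. *)
Lemma t_contraction_eq0 (V : 'cV[{fps S[n]}]_n) (A : 'M[{fps S[n]}]_n) :
  V = fpsC n (fpsX K ord0) *: (A *m V) -> V = 0.
Proof.
move=> VE; have V_ge d : forall i, t_order_ge d (V i 0).
  elim: d => [|d IH] i m; first by [].
  rewrite VE !mxE fpsCM; apply: (@order_geM _ _ 1 d); first exact: order_ge_fpsX.
  have : t_order_ge d (\sum_j A i j * V j 0).
    by apply: t_order_ge_sum => j _; apply: t_order_geMl.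
  exact.
by apply/colP => i; rewrite mxE; apply: t_order_ge_eq0 => d.
Qed.

Lemma cauchy_unique (H : 'cV[{fps K[n]}]_n) (M M' : 'cV[{fps S[n]}]_n) :
  cauchy_solution H M -> cauchy_solution H M' -> M = M'.
Proof.
move=> [Mt M0] [M't M'0]; apply/eqP; rewrite -subr_eq0; apply/eqP.
(* JM M - JM' M' = J(M - M') M + JM' (M - M'). *)
apply: (@cauchy_linear_unique _ M (jacobian M')).
  by rewrite fmap_dtB Mt M't jacobianB mulmxBl mulmxBr addrA subrK.
have t0E : fmap_t0 (M - M') = fmap_t0 M - fmap_t0 M'.
  by apply/colP => i; rewrite !mxE; apply: fpsP.
by rewrite t0E M0 M'0 subrr.
Qed.

End TAdic.

(** * The Cauchy problem and the inverse relations over K[[t]] *)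

Section CauchyProblem.
Variables (K : numDomainType) (n : nat).
Local Notation S := {fps K[1]}.
Local Notation T := (fpsC n (fpsX K ord0)).
Variables (H : 'cV[{fps K[n]}]_n) (N : 'cV[{fps S[n]}]_n).
Hypothesis H1 : forall i, order_ge 1 (H i 0).
Hypothesis N1 : forall i, order_ge 1 (N i 0).

Let Hs : 'cV[{fps S[n]}]_n := map_mx (fps_map (@fpsC K 1)) H.
Let G := fmap_id S n + T *: N.
Let F := fmap_id S n - T *: Hs.

Let Hs1 i : order_ge 1 (Hs i 0).
Proof. by rewrite mxE; apply: order_ge_map. Qed.

Let G1 i : order_ge 1 (G i 0).
Proof. exact: order_ge_deformation. Qed.

Let F1 i : order_ge 1 (F i 0).
Proof.
have -> : F = fmap_id S n + T *: (- Hs) by rewrite scalerN.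
by apply: order_ge_deformation => j m lt; rewrite mxE /= Hs1 ?oppr0.
Qed.

Let Hs_t : fmap_dt Hs = 0.
Proof.
by apply/colP => i; rewrite !mxE; apply: fpsP => m; rewrite /= fps_derivC.
Qed.

Let t0E (M : 'cV[{fps S[n]}]_n) : fmap_t0 M = map_mx (fps_map (@fps_ev0 K 1)) M.
Proof. by []. Qed.

Let Hs_t0 : fmap_t0 Hs = H.
Proof.
by apply/colP => i; rewrite !mxE; apply: fpsP => m; rewrite /= eqxx.
Qed.

Let t0D (M M' : 'cV[{fps S[n]}]_n) : fmap_t0 (M + M') = fmap_t0 M + fmap_t0 M'.
Proof. by apply/colP => i; rewrite !mxE; apply: fpsP. Qed.

Let t0B (M M' : 'cV[{fps S[n]}]_n) : fmap_t0 (M - M') = fmap_t0 M - fmap_t0 M'.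
Proof. by apply/colP => i; rewrite !mxE; apply: fpsP. Qed.

Let tZ_t0 (M : 'cV[{fps S[n]}]_n) : fmap_t0 (T *: M) = 0.
Proof.
apply/colP => i; rewrite !mxE; apply: fpsP => m.
rewrite -[LHS]/(fps_ev0 ((T * M i 0) m)) fpsCM rmorphM /=.
by rewrite eq_sym mnm1_eq0 mul0r.
Qed.

Let G_t0 : fmap_t0 G = fmap_id K n.
Proof. by rewrite t0D tZ_t0 addr0 t0E map_fmap_id. Qed.

Let F_t0 : fmap_t0 F = fmap_id K n.
Proof. by rewrite t0B tZ_t0 subr0 t0E map_fmap_id. Qed.

Let comp_t0 (M M' : 'cV[{fps S[n]}]_n) : fmap_t0 M' = fmap_id K n ->
  fmap_t0 (fmap_comp M M') = fmap_t0 M.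
Proof. by move=> M'0; rewrite t0E map_fmap_comp -!t0E M'0 fmap_comp_id. Qed.

Let A := map_mx (fun f => fps_comp f G) (jacobian Hs).

Let HG_t : fmap_dt (fmap_comp Hs G) = A *m (N + T *: fmap_dt N).
Proof.
rewrite fmap_dt_comp // Hs_t fmap_dtD fmap_dt_id fmap_dt_tZ add0r -/A.
rewrite -[RHS]add0r; congr (_ + _); apply/colP => i; rewrite !mxE.
by apply: fpsP => m /=; rewrite big1 // => a _; rewrite mul0r.
Qed.

Let HG_jacobian : jacobian (fmap_comp Hs G) = A + T *: (A *m jacobian N).
Proof.
by rewrite jacobian_comp // jacobianD jacobian_id jacobianZ mulmxDr mulmx1 scalemxAr.
Qed.

Lemma fixpoint_cauchy : N = fmap_comp Hs G -> cauchy_solution H N.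
Proof.
move=> NE; split; last by rewrite NE comp_t0.
apply/eqP; rewrite -subr_eq0; apply/eqP.
apply: (@t_contraction_eq0 _ _ _ A).
have Nt : fmap_dt N = A *m (N + T *: fmap_dt N) by rewrite -HG_t -NE.
have JN : jacobian N = A + T *: (A *m jacobian N) by rewrite -HG_jacobian -NE.
(* Each equation is unfolded only once: the terms A N cancel, and what remains is tA applied to the
   original difference. *)
rewrite {1}Nt {1}JN mulmxDl mulmxDr -scalemxAr -scalemxAl -mulmxA.
by rewrite opprD addrACA subrr add0r -scalerBr -mulmxBr.
Qed.

(** Substituting dN/dt = JN N turns the derivative of H(G) into (A + tA JN) N = J(H(G)) N, so N and
    H(G) satisfy the same linear transport equation with the same initial value. *)
Lemma cauchy_fixpoint : cauchy_solution H N -> N = fmap_comp Hs G.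
Proof.
move=> [Nt N0]; apply/eqP; rewrite -subr_eq0; apply/eqP.
apply: (@cauchy_linear_unique _ _ _ N 0); last first.
  by rewrite t0B N0 comp_t0 // Hs_t0 subrr.
rewrite mul0mx addr0 fmap_dtB HG_t jacobianB HG_jacobian Nt.
by rewrite mulmxBl mulmxDl mulmxDr -scalemxAr -scalemxAl mulmxA.
Qed.

(** Since dF/dt = -H, the chain rule gives d/dt N(F) = (JN)(F) (N(F) - H), a linear equation without
    a Jacobian term in the unknown. *)
Lemma cauchy_comp : cauchy_solution H N -> fmap_comp N F = Hs.
Proof.
move=> [Nt N0]; apply/eqP; rewrite -subr_eq0; apply/eqP.
apply: (@cauchy_linear_unique _ _ _ 0 (map_mx (fun f => fps_comp f F) (jacobian N))).
  have F_t : fmap_dt F = - Hs.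
    by rewrite fmap_dtB fmap_dt_id fmap_dt_tZ Hs_t scaler0 addr0 sub0r.
  have NF_t := fmap_dt_comp N F1.
  rewrite F_t Nt (fmap_comp_mulmx _ _ F1) in NF_t.
  rewrite fmap_dtB Hs_t subr0 NF_t.
  by rewrite mulmx0 add0r mulmxBr mulmxN.
by rewrite t0B comp_t0 // N0 Hs_t0 subrr.
Qed.

End CauchyProblem.

Lemma fmap_order_ge1 (R : comNzRingType) (n k : nat) (U : 'cV[{fps R[n]}]_k) :
  (1 <= fmap_order U)%E -> forall i, order_ge 1 (U i 0).
Proof. by move=> /(fmap_order_geP U 1) U1 i m; apply: U1. Qed.

(** * Inverse relations over K[t] and their transfer to K[[t]] *)

Section Inversion.
Variables (K : numDomainType) (n : nat).
Variables (H : 'cV[{fps K[n]}]_n) (N : 'cV[{fps {poly K}[n]}]_n).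
Hypothesis H1 : forall i, order_ge 1 (H i 0).
Hypothesis N1 : forall i, order_ge 1 (N i 0).

Local Notation z := (fmap_id {poly K} n).
Local Notation t := (fmap_t K n).

Let tZ_inj (U V : 'cV[{fps {poly K}[n]}]_n) : t *: U = t *: V -> U = V.
Proof.
move=> e; apply/colP => i; apply: fpsP => m.
have /colP/(_ i) := e; rewrite !mxE => /(congr1 (fun h : {fps {poly K}[n]} => h m)).
by rewrite !fpsCM => /(mulfI (negbT (polyX_eq0 K))).
Qed.

Let ord_HC i : order_ge 1 (fmap_polyC H i 0).
Proof. by rewrite mxE; apply: order_ge_map. Qed.

(** The two compositions are G - tH(G) and F + tN(F); equating them to z and cancelling t, which is
    regular in K[t], leaves the two relations. *)
Lemma formal_inverseE :
  is_formal_inverse (z - t *: fmap_polyC H) (z + t *: N) <->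
  N = fmap_comp (fmap_polyC H) (z + t *: N) /\
  fmap_comp N (z - t *: fmap_polyC H) = fmap_polyC H.
Proof.
have G1 := order_ge_deformation 'X N1.
have F1 i : order_ge 1 ((z - t *: fmap_polyC H) i 0).
  rewrite -scalerN; apply: order_ge_deformation => j m lt.
  by rewrite mxE /= ord_HC ?oppr0.
rewrite /is_formal_inverse fmap_compB fmap_compD !fmap_compZ !id_fmap_comp //.
split=> [[FG GF]|[FG GF]]; split.
- apply: tZ_inj; apply/(addrI z)/eqP; rewrite -subr_eq; apply/eqP.
  by rewrite FG.
- apply: tZ_inj; apply/(addrI (z - t *: fmap_polyC H)).
  by rewrite subrK.
- by rewrite -FG addrK.
by rewrite GF subrK.
Qed.

(** Brings identities proved over K[[t]] back to K[t]. *)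
Lemma fmap_poly_fps_inj : injective (@fmap_poly_fps K n).
Proof.
move=> U V /colP e; apply/colP => i; apply: fpsP => m.
have := e i; rewrite !mxE => /(congr1 (fun h : {fps {fps K[1]}[n]} => h m)).
exact: poly_fps_inj.
Qed.

Lemma fmap_poly_fps_comp (U V : 'cV[{fps {poly K}[n]}]_n) :
  fmap_poly_fps (fmap_comp U V) = fmap_comp (fmap_poly_fps U) (fmap_poly_fps V).
Proof. exact: map_fmap_comp. Qed.

Lemma fmap_poly_fps_C :
  fmap_poly_fps (fmap_polyC H) = map_mx (fps_map (@fpsC K 1)) H.
Proof. by apply/colP => i; rewrite !mxE; apply: fpsP => m; apply: poly_fpsC. Qed.

Lemma fmap_poly_fps_tZ (U : 'cV[{fps {poly K}[n]}]_n) :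
  fmap_poly_fps (t *: U) = fpsC n (fpsX K ord0) *: fmap_poly_fps U.
Proof. by rewrite /fmap_poly_fps map_mxZ /= fps_mapC /= poly_fpsX. Qed.

(** After transfer to K[[t]], the relation N = H(G) yields the Cauchy problem, and the Cauchy
    problem yields both inverse relations. *)
Lemma formal_inverse_cauchy :
  is_formal_inverse (z - t *: fmap_polyC H) (z + t *: N) <->
  cauchy_solution H (fmap_poly_fps N).
Proof.
have N1' i : order_ge 1 (fmap_poly_fps N i 0).
  by rewrite mxE; apply: order_ge_map.
have zE : fmap_poly_fps z = fmap_id {fps K[1]} n by apply: map_fmap_id.
have GE : fmap_poly_fps (z + t *: N) =
    fmap_id {fps K[1]} n + fpsC n (fpsX K ord0) *: fmap_poly_fps N.
  by rewrite -fmap_poly_fps_tZ -zE -raddfD.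
have FE : fmap_poly_fps (z - t *: fmap_polyC H) =
    fmap_id {fps K[1]} n
      - fpsC n (fpsX K ord0) *: map_mx (fps_map (@fpsC K 1)) H.
  by rewrite -fmap_poly_fps_C -fmap_poly_fps_tZ -zE -raddfB.
rewrite formal_inverseE; split=> [[NE _]|sol].
  apply: fixpoint_cauchy => //.
  by rewrite {1}NE fmap_poly_fps_comp fmap_poly_fps_C GE.
split; apply: fmap_poly_fps_inj; rewrite fmap_poly_fps_comp fmap_poly_fps_C.
  by rewrite GE; apply: cauchy_fixpoint.
by rewrite FE; apply: cauchy_comp.
Qed.

End Inversion.

Theorem theorem2p4 (R : realType) (n : nat)
    (H : 'cV[{fps (R[i])[n]}]_n) (N : 'cV[{fps {poly R[i]}[n]}]_n) :
  (1 <= n)%N ->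
  (1 <= fmap_order H)%E ->
  (1 <= fmap_order N)%E ->
  is_formal_inverse (fmap_id {poly R[i]} n - fmap_t R[i] n *: fmap_polyC H)
                    (fmap_id {poly R[i]} n + fmap_t R[i] n *: N)
  <-> unique (cauchy_solution H) (fmap_poly_fps N).
Proof.
move=> _ /fmap_order_ge1 H1 /fmap_order_ge1 N1.
rewrite formal_inverse_cauchy //; split=> [sol|[]//].
(* The competitor [M] ranges over all of K[[t]][[z]], with any order in z. *)
by split=> // M; apply: cauchy_unique.
Qed.
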